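(* Let $\mathcal{B}$ be a reflexive, strictly convex real Banach space. A function $\Omega\colon\mathcal{B}\to\mathbb{R}$ is admissible if and only if there exist a nondecreasing function $h\colon[0,\infty)\to\mathbb{R}$ and an at most countable set $\mathcal{R}\subset[0,\infty)$ of radii at which $h$ has a jump discontinuity such that $$\Omega(f)=h(\|f\|_{\mathcal{B}})\qquad\text{for every } f\in\mathcal{B}\text{ with }\|f\|_{\mathcal{B}}\notin\mathcal{R},$$ and, for every $f\in\mathcal{B}$ with $\|f\|_{\mathcal{B}}=r\in\mathcal{R}$, the value $\Omega(f)$ is constrained only by monotonicity, i.e. $$\lim_{t\nearrow r}h(t)\le\Omega(f)\le\lim_{t\searrow r}h(t).$$
   Context: For a real Banach space $\mathcal{B}$ with dual $\mathcal{B}^*$, the duality mapping $J\colon\mathcal{B}\to 2^{\mathcal{B}^*}$ is $$J(x)=\{L\in\mathcal{B}^* : L(x)=\|L\|\cdot\|x\|,\ \|L\|=\|x\|\},$$ so $J(0)=\{0\}$. Fix a set $Y\subseteq\mathbb{R}$ of possible outputs (typical examples: $Y=\mathbb{R}$ or $Y=\{-1,1\}$). Given $L_1,\dots,L_m\in\mathcal{B}^*$ and $y_1,\dots,y_m\in Y$, the regularised interpolation problem is $$\min\{\Omega(f) : f\in\mathcal{B},\ L_i(f)=y_i\ \text{for all } i=1,\dots,m\}.$$ A function $\Omega\colon\mathcal{B}\to\mathbb{R}$ is called admissible if for any $m\in\mathbb{N}$ and any data $L_1,\dots,L_m\in\mathcal{B}^*$, $y_1,\dots,y_m\in Y$ for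 which the interpolation constraints can be satisfied, the regularised interpolation problem admits a solution $f$ for which there exist $c_1,\dots,c_m\in\mathbb{R}$ with $\sum_{i=1}^m c_iL_i\in J(f)$. If $r=0$ there is no left-hand limit of $h$ at $r$, and only the upper bound is imposed.
   Formalization: It is additionally assumed that B is not one-dimensional and that Y contains a nonzero value (otherwise e.g. Ω(f)=sin²‖f‖ is admissible but not of the stated form); m=0, i.e. unconstrained minimisation of Ω, is allowed in the definition of admissible. *)

(* Defs.v *)
From HB Require Import structures.
From mathcomp Require Import all_boot all_order all_algebra.
From mathcomp Require Import all_classical all_reals.
From mathcomp Require Import topology normedtype numfun realfun.

Set Implicit Arguments.
Unset Strict Implicit.
Unset Printing Implicit Defensive.

Import Order.TTheory GRing.Theory Num.Theory.
Import numFieldNormedType.Exports.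

Local Open Scope classical_set_scope.
Local Open Scope ring_scope.

Section dual_space.
Context {R : realType} (B : normedModType R).

Definition continuous_linear : {pred B -> R^o} :=
  mem [set f : B -> R^o | linear f /\ continuous f].

Lemma continuous_linear_submod_closed : submod_closed continuous_linear.
Proof.
split=> [|a f g].
  rewrite inE; split; last by move=> x; exact: cvg_cst.
  by move=> a x y; rewrite /= scaler0 addr0.
rewrite !inE => -[lf cf] [lg cg]; split.
  move=> k x y; rewrite -[LHS]/(a *: f (k *: x + y) + g (k *: x + y)) lf lg.
  rewrite -[(a *: f + g) x]/(a *: f x + g x).
  rewrite -[(a *: f + g) y]/(a *: f y + g y).
  by rewrite !scalerDr !scalerA (mulrC a k) addrACA.
move=> x; apply: (@cvgD _ _ _ _ _ (a \*: f) g); last exact: cg.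
by apply: cvgZr; exact: cf.
Qed.

HB.instance Definition _ :=
  GRing.isSubmodClosed.Build R (B -> R^o) continuous_linear
    continuous_linear_submod_closed.

Record dual_space := DualSpace {
  dual_fun :> B -> R^o ;
  dual_funP : dual_fun \in continuous_linear }.

HB.instance Definition _ := [isSub for dual_fun].
HB.instance Definition _ := [Choice of dual_space by <:].
HB.instance Definition _ := [SubChoice_isSubLmodule of dual_space by <:].

Implicit Types (L : dual_space) (x : B).

Definition dual_norm L : R :=
  sup [set `|L x| | x in [set x : B | `|x| <= 1]].

Let toLin L : {linear B -> R^o} :=
  HB.pack (dual_fun L)
    (GRing.isLinear.Build _ _ _ _ (dual_fun L) (set_mem (dual_funP L)).1).

Let dual0 L : L 0 = 0. Proof. exact: (linear0 (toLin L)). Qed.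

Let dualZ L a x : L (a *: x) = a * L x.
Proof. exact: (linearZ_LR (toLin L)). Qed.

Let dual_norm_has_sup L :
  has_sup [set `|L x| | x in [set x : B | `|x| <= 1]].
Proof.
split; first by exists `|L 0|, 0 => //=; rewrite normr0.
have /linear_bounded_continuous/linear_boundedP/pinfty_ex_gt0[M M0 LM] :
  continuous (toLin L) := (set_mem (dual_funP L)).2.
exists M => _ [x /= x1 <-]; apply: le_trans (LM x) _.
by rewrite ler_piMr// ltW.
Qed.

Lemma dual_norm_ge L x : `|x| <= 1 -> `|L x| <= dual_norm L.
Proof.
by move=> x1; apply: ub_le_sup; [case: (dual_norm_has_sup L)|exists x].
Qed.

Lemma dual_norm_le L M :
  (forall x, `|x| <= 1 -> `|L x| <= M) -> dual_norm L <= M.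
Proof.
move=> LM; apply: ge_sup; first by case: (dual_norm_has_sup L).
by move=> _ [x /= x1 <-]; exact: LM.
Qed.

Let dual_norm_ge0 L : 0 <= dual_norm L.
Proof.
by apply: le_trans (normr_ge0 (L 0)) _; apply: dual_norm_ge; rewrite normr0.
Qed.

Lemma dual_normD L1 L2 :
  dual_norm (L1 + L2) <= dual_norm L1 + dual_norm L2.
Proof.
apply: dual_norm_le => x x1; apply: le_trans (ler_normD _ _) _.
by apply: lerD; exact: dual_norm_ge.
Qed.

Let dual_normZ_le a L : dual_norm (a *: L) <= `|a| * dual_norm L.
Proof.
apply: dual_norm_le => x x1; rewrite [X in X <= _](normrM a (L x)).
by rewrite ler_wpM2l// dual_norm_ge.
Qed.

Lemma dual_normZ a L : dual_norm (a *: L) = `|a| * dual_norm L.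
Proof.
apply/eqP; rewrite eq_le dual_normZ_le /=.
have [->|a0] := eqVneq a 0; first by rewrite normr0 mul0r.
rewrite -ler_pdivlMl ?normr_gt0// -normfV.
by have := dual_normZ_le a^-1 (a *: L); rewrite scalerA mulVf// scale1r.
Qed.

Lemma dual_norm0_eq0 L : dual_norm L = 0 -> L = 0.
Proof.
move=> L0; apply/val_inj/funext => x /=.
have [->|x0] := eqVneq x 0; first exact: dual0.
have nx0 : `|x| != 0 by rewrite normr_eq0.
have : `|L (`|x|^-1 *: x)| <= 0.
  by rewrite -L0; apply: dual_norm_ge; rewrite normrZ normfV normr_id mulVf.
rewrite dualZ normr_le0 mulf_eq0 invr_eq0 (negbTE nx0)/= => /eqP ->.
by [].
Qed.

HB.instance Definition _ := Lmodule_isNormed.Build R dual_space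
  dual_normD dual_normZ dual_norm0_eq0.

End dual_space.

Definition reflexive_space {R : realType} (B : normedModType R) : Prop :=
  forall phi : dual_space (dual_space B),
    exists x : B, forall L : dual_space B, phi L = L x.

Definition strictly_convex_space {R : realType} (B : normedModType R) : Prop :=
  forall (x y : B) (t : R), `|x| = 1 -> `|y| = 1 -> x != y -> 0 < t < 1 ->
    `|t *: x + (1 - t) *: y| < 1.

(* On a one-dimensional space every nonzero functional determines its argument,
   so that [admissible] says only that [0] minimises [Omega]: there the
   characterisation by monotone functions of the norm is false. *)
Definition one_dimensional {R : realType} (B : normedModType R) : Prop :=
  exists2 e : B, e != 0 & forall x : B, exists a : R, x = a *: e.

Definition duality_map {R : realType} (B : normedModType R) (x : B) :
    set (dual_space B) :=
  [set L : dual_space B | L x = `|L| * `|x| /\ `|L| = `|x|].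

Section interpolation.
Context {R : realType} (B : normedModType R).

Definition interpolates (m : nat) (L : 'I_m -> dual_space B) (y : 'I_m -> R) :
    set B :=
  [set f | forall i, L i f = y i].

Definition interpolation_solution (Omega : B -> R) (m : nat)
    (L : 'I_m -> dual_space B) (y : 'I_m -> R) : set B :=
  [set f | interpolates L y f /\
           forall g, interpolates L y g -> Omega f <= Omega g].

(* [m = 0] is allowed: the problem is then the unconstrained minimisation of
   [Omega], and the empty linear combination is [0]. *)
Definition admissible (Y : set R) (Omega : B -> R) : Prop :=
  forall (m : nat) (L : 'I_m -> dual_space B) (y : 'I_m -> R),
    (forall i, Y (y i)) ->
    interpolates L y !=set0 ->
    exists2 f, interpolation_solution Omega L y f &
      exists c : 'I_m -> R, duality_map f (\sum_(i < m) c i *: L i).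

End interpolation.

(* A function on [0, +oo) is encoded by a function on [R] whose values on the
   negative reals are irrelevant. In particular there is no left-hand limit at
   [0], where a jump is a right-hand limit that differs from the value. *)
Definition jump_discontinuity {R : realType} (h : R -> R) (r : R) : Prop :=
  if r == 0 then cvg (h t @[t --> 0^'+]) /\ h 0 != lim (h t @[t --> 0^'+])
  else discontinuity h r.

(* Main.v *)
(* Write [f ~> g] when [g] lies on a tangent hyperplane, at [f], to the ball of
   radius [`|f|] around [0].
   Admissible implies radial: interpolating a single functional that norms [f],
   strict convexity leaves [f] as the only candidate solution, so
   [f ~> g] implies [Omega f <= Omega g]. Tangential steps within a plane connect
   [f] to every [g] with [`|f| < `|g|]: [n] steps turn [f] into a multiple of [g]
   while the total radial growth is [O(1 / n)], because the growth of one step is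
   a telescoping difference times [1 / n]; two further steps realise any dilation
   exactly. Hence [Omega] is nondecreasing in the norm, and [h t = Omega (t e)]
   for a unit vector [e].
   Radial implies admissible: by Hahn-Banach on the dual space and reflexivity
   there is an interpolant of minimal norm. It is unique by strict convexity, so
   it minimises [Omega]. It is also orthogonal, in the sense of Birkhoff and
   James, to the common kernel of the [L_i], hence normed by a functional that
   vanishes on this kernel, that is by a combination of the [L_i]. *)

Require Import Defs.
From HB Require Import structures.
From mathcomp Require Import all_boot all_order all_algebra.
From mathcomp Require Import all_classical all_reals.
From mathcomp Require Import topology normedtype numfun realfun derive.
From mathcomp Require Import lra ring.
Import Order.TTheory GRing.Theory Num.Theory.
Import numFieldNormedType.Exports.
Local Open Scope classical_set_scope.
Local Open Scope ring_scope.

Set Implicit Arguments.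
Unset Strict Implicit.
Unset Printing Implicit Defensive.

(** * The Hahn-Banach theorem *)

Definition sublinear {R : realType} {V : lmodType R} (q : V -> R) : Prop :=
  (forall x y, q (x + y) <= q x + q y) /\
  (forall a x, 0 <= a -> q (a *: x) = a * q x).

Lemma sublinear0 {R : realType} {V : lmodType R} (q : V -> R) :
  sublinear q -> q 0 = 0.
Proof. by case=> _ qZ; have := qZ 0 0 (lexx _); rewrite scale0r mul0r. Qed.

Lemma sublinear_opp_ge {R : realType} {V : lmodType R} (q : V -> R) (x : V) :
  sublinear q -> - q (- x) <= q x.
Proof.
move=> sq; have := sq.1 x (- x); rewrite subrr (sublinear0 sq); lra.
Qed.

(** Common source of the sublinear functionals below: infimal convolutions, and lower bounds of
    chains in Zorn's lemma. *)
Lemma sublinear_inf {R : realType} {V : lmodType R} (E : V -> set R) :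
  (forall x, E x !=set0) -> (forall x, has_lbound (E x)) ->
  (forall x y r s, E x r -> E y s -> exists2 t, E (x + y) t & t <= r + s) ->
  (forall a x r, 0 < a -> E x r -> E (a *: x) (a * r)) ->
  E 0 0 -> (forall r, E 0 r -> 0 <= r) ->
  sublinear (fun x => inf (E x)).
Proof.
move=> E0 Eb ED EZ E00 E0ge; split=> [x y|a x].
  rewrite -lerBlDr; apply: lb_le_inf => // r xr.
  rewrite lerBlDr -lerBlDl; apply: lb_le_inf => // s ys.
  have [t xyt trs] := ED _ _ _ _ xr ys.
  by rewrite lerBlDl; apply: le_trans trs; apply: ge_inf.
rewrite le_eqVlt => /predU1P[<-|a0].
  rewrite scale0r mul0r; apply/eqP; rewrite eq_le; apply/andP; split.
    exact: ge_inf.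
  exact: lb_le_inf.
apply/eqP; rewrite eq_le; apply/andP; split.
  rewrite -ler_pdivrMl//; apply: lb_le_inf => // r xr.
  by rewrite ler_pdivrMl//; apply: ge_inf => //; exact: EZ.
apply: lb_le_inf => // r xr; rewrite -ler_pdivlMl//; apply: ge_inf => //.
have ai : 0 < a^-1 by rewrite invr_gt0.
by have := EZ _ _ _ ai xr; rewrite scalerA mulVf ?scale1r// gt_eqF.
Qed.

(* The infimal convolution of [q] with a superlinear functional on a convex
   cone, given by its graph [G], so that no functional relation is needed. *)
Lemma sublinear_infconv {R : realType} {V : lmodType R} (q : V -> R)
    (G : set (V * R)) :
  sublinear q -> G (0, 0) ->
  (forall u v r s, G (u, r) -> G (v, s) -> G (u + v, r + s)) ->
  (forall a u r, 0 < a -> G (u, r) -> G (a *: u, a * r)) ->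
  (forall u r, G (u, r) -> r <= q u) ->
  exists2 p, sublinear p &
    forall x w r, G (w, r) -> p x <= q (x + w) - r.
Proof.
move=> sq G0 GD GZ Gq; pose E x := [set q (x + w.1) - w.2 | w in G].
have Eb x : has_lbound (E x).
  exists (- q (- x)) => _ [[w r] Gw <-] /=.
  have := sq.1 (x + w) (- x); rewrite addrAC subrr add0r; have := Gq _ _ Gw; lra.
exists (fun x => inf (E x)); last by move=> x w r Gw; apply: ge_inf => //; exists (w, r).
apply: sublinear_inf => //.
- by move=> x; exists (q (x + 0) - 0), (0, 0).
- move=> x y _ _ [[u r] Gu <-] [[v s] Gv <-] /=.
  exists (q (x + y + (u + v)) - (r + s)).
    by exists (u + v, r + s) => //; exact: GD.
  by rewrite addrACA; have := sq.1 (x + u) (y + v); lra.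
- move=> a x _ a0 [[u r] Gu <-] /=; exists (a *: u, a * r); first exact: GZ.
  by rewrite /= -scalerDr sq.2 ?ltW// mulrBr.
- by exists (0, 0); rewrite //= add0r (sublinear0 sq) subrr.
- by move=> _ [[w r] Gw <-]; rewrite add0r subr_ge0 Gq.
Qed.

Lemma minimal_sublinear {R : realType} {V : lmodType R} (q : V -> R) :
  sublinear q ->
  exists2 p, sublinear p /\ (forall x, p x <= q x) &
    forall p', sublinear p' -> (forall x, p' x <= p x) ->
      forall x, p x <= p' x.
Proof.
move=> sq; pose P p := sublinear p /\ forall x, p x <= q x.
pose T := {p : V -> R | P p}.
have Pq : P q by split.
(* The order is reversed, so that a maximal element in Zorn's lemma is a pointwise minimal
   functional. *)
pose le (s t : T) : bool := `[< forall x, sval t x <= sval s x >].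
have [||A Atot|[p Pp] pmin] := @ZL_preorder T (exist P q Pq) le.
- by move=> t; apply/asboolP => x.
- move=> r s t /asboolP rs /asboolP st; apply/asboolP => x.
  exact: le_trans (st x) (rs x).
- have [->|/set0P[t0 At0]] := eqVneq A set0; first by exists (exist P q Pq).
  pose E x := [set sval t x | t in A].
  have Eb x : has_lbound (E x).
    exists (- q (- x)) => _ [t At <-].
    apply: le_trans (sublinear_opp_ge x (svalP t).1).
    by rewrite lerN2; exact: (svalP t).2.
  suff PE : P (fun x => inf (E x)).
    exists (exist P _ PE) => s As; apply/asboolP => x /=.
    by apply: ge_inf => //; exists s.
  split; last first.
    move=> x; apply: le_trans ((svalP t0).2 x).
    by apply: ge_inf => //; exists t0.
  apply: sublinear_inf => //.
  + by move=> x; exists (sval t0 x), t0.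
  + move=> x y _ _ [s As <-] [t At <-].
    have [/asboolP st|/asboolP ts] := Atot s t As At.
      exists (sval t (x + y)); first by exists t.
      apply: le_trans ((svalP t).1.1 x y) _; exact: lerD.
    exists (sval s (x + y)); first by exists s.
    apply: le_trans ((svalP s).1.1 x y) _; exact: lerD.
  + move=> a x _ a0 [s As <-]; exists s => //.
    by rewrite (svalP s).1.2// ltW.
  + by exists t0; rewrite // (sublinear0 (svalP t0).1).
  + by move=> _ [s As <-]; rewrite (sublinear0 (svalP s).1).
- exists p => // p' sp' p'p x.
  have Pp' : P p' by split=> // y; apply: le_trans (p'p y) (Pp.2 y).
  have := pmin (exist P p' Pp'); rewrite /le => /(_ _)/asboolP; apply.
  by apply/asboolP.
Qed.

(** A minimal sublinear [p] is additive: its infimal convolution with the ray through [a] lies below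
    [p], so by minimality also above it, and this yields [p x + p a <= p (x + a)]. *)
Lemma sublinear_dominates_linear {R : realType} {V : lmodType R} (q : V -> R) :
  sublinear q ->
  exists2 f : V -> R^o, linear f & forall x, f x <= q x.
Proof.
move=> /minimal_sublinear[p [sp pq] pmin]; exists p => //.
have pD x a : p (x + a) = p x + p a.
  apply/eqP; rewrite eq_le sp.1 /=.
  have [||||p' sp' p'le] :=
    @sublinear_infconv R V p [set (t *: a, t * p a) | t in [set t | 0 <= t]] sp.
  - by exists 0; rewrite /= ?scale0r ?mul0r.
  - move=> _ _ _ _ [s s0 [<- <-]] [t t0 [<- <-]].
    by exists (s + t); rewrite /= ?scalerDl ?mulrDl//= addr_ge0.
  - move=> b _ _ b0 [s s0 [<- <-]].
    by exists (b * s); rewrite /= ?scalerA ?mulrA ?mulr_ge0// ltW.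
  - by move=> _ _ [s s0 [<- <-]]; rewrite sp.2.
  have p'p y : p' y <= p y.
    have := p'le y 0 0; rewrite addr0 subr0; apply.
    by exists 0; rewrite /= ?scale0r ?mul0r.
  have := le_trans (pmin _ sp' p'p x) (p'le x a (p a) _).
  by rewrite lerBrDr; apply; exists 1; rewrite /= ?scale1r ?mul1r.
have pN x : p (- x) = - p x.
  by apply/eqP; rewrite -addr_eq0 -pD addNr (sublinear0 sp).
have pZ a x : p (a *: x) = a * p x.
  have [/sp.2->//|a0] := leP 0 a.
  by rewrite -[a]opprK scaleNr pN sp.2 ?mulNr// oppr_ge0 ltW.
by move=> a x y; rewrite pD pZ.
Qed.

(** A linear [f] below the infimal convolution [p] works: at [- w] the bound on [p] reads
    [- f w <= q 0 - r]. Where [G] contains opposite pairs, the one-sided bound becomes an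
    equality. *)
Theorem hahn_banach {R : realType} {V : lmodType R} (q : V -> R)
    (G : set (V * R)) :
  sublinear q -> G (0, 0) ->
  (forall u v r s, G (u, r) -> G (v, s) -> G (u + v, r + s)) ->
  (forall a u r, 0 < a -> G (u, r) -> G (a *: u, a * r)) ->
  (forall u r, G (u, r) -> r <= q u) ->
  exists f : V -> R^o, [/\ linear f, forall x, f x <= q x &
    forall w r, G (w, r) -> r <= f w].
Proof.
move=> sq G0 GD GZ Gq.
have [p sp ple] := sublinear_infconv sq G0 GD GZ Gq.
have [f lf fp] := sublinear_dominates_linear sp.
exists f; split=> // [x|w r Gw].
  by apply: le_trans (fp x) _; have := ple x 0 0 G0; rewrite addr0 subr0.
have := le_trans (fp (- w)) (ple (- w) w r Gw).
have -> : f (- w) = - f w.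
  have f0 : f 0 = 0.
    by have := lf (-1) 0 0; rewrite scaler0 add0r scaleN1r addNr.
  by have := lf (-1) w 0; rewrite f0 !addr0 !scaleN1r.
rewrite addNr (sublinear0 sq); lra.
Qed.

(** * Norming functionals *)

(* Typing the value in [R] rather than in [R^o] keeps it within the reach of
   [lra] and of the lemmas on real numbers. *)
Definition ev {R : realType} {B : normedModType R} (L : dual_space B) (x : B) : R :=
  L x.

Section dual_facts.
Context {R : realType} {B : normedModType R}.
Implicit Types (L : dual_space B) (x y : B).

Lemma dual_linear L : linear (L : B -> R^o).
Proof. by have [] := set_mem (dual_funP L). Qed.

Lemma dualD L x y : ev L (x + y) = ev L x + ev L y.
Proof. by rewrite /ev; have := dual_linear L 1 x y; rewrite !scale1r. Qed.

Lemma dual0 L : ev L 0 = 0.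
Proof. by have := dualD L 0 0; rewrite addr0; lra. Qed.

Lemma dualZ L a x : ev L (a *: x) = a * ev L x.
Proof.
have := dual_linear L a x 0; rewrite addr0 -[L 0]/(ev L 0) dual0 addr0; exact.
Qed.

Lemma dualN L x : ev L (- x) = - ev L x.
Proof. by rewrite -scaleN1r dualZ mulN1r. Qed.

Lemma dualB L x y : ev L (x - y) = ev L x - ev L y.
Proof. by rewrite dualD dualN. Qed.

Lemma dual_scaleE L a x : ev (a *: L) x = a * ev L x. Proof. by []. Qed.

Lemma dual_sumE (m : nat) (L : 'I_m -> dual_space B) x :
  ev (\sum_(i < m) L i) x = \sum_(i < m) ev (L i) x.
Proof. exact: (big_morph (fun L : dual_space B => ev L x)). Qed.

Lemma norm_dual_le L x : `|x| <= 1 -> `|ev L x| <= `|L|.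
Proof. by move=> x1; have := dual_norm_ge L x1; apply. Qed.

Lemma dual_le_norm L x : ev L x <= `|L| * `|x|.
Proof.
have [->|x0] := eqVneq x 0; first by rewrite dual0 normr0 mulr0.
have nx : 0 < `|x| by rewrite normr_gt0.
apply: le_trans (ler_norm _) _.
rewrite -ler_pdivrMr// mulrC -[X in X * _]gtr0_norm ?invr_gt0//.
rewrite -normrM -dualZ; apply: norm_dual_le.
by rewrite normrZ normfV normr_id mulVf ?gt_eqF.
Qed.

Lemma dual_norm_le_bound L M : 0 <= M ->
  (forall x, ev L x <= M * `|x|) -> `|L| <= M.
Proof.
move=> M0 LM; have := @dual_norm_le _ _ L M; apply=> x x1.
have xM : M * `|x| <= M by rewrite ler_piMr.
suff: `|ev L x| <= M by apply.
rewrite ler_norml lerNl -dualN; apply/andP; split; last exact: le_trans xM.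
by apply: le_trans (LM _) _; rewrite normrN.
Qed.

Lemma dominated_linear_dual (f : B -> R^o) M : linear f ->
  (forall x, f x <= M * `|x|) -> exists L, forall x, ev L x = f x.
Proof.
move=> lf fM.
pose F : {linear B -> R^o} := HB.pack f (GRing.isLinear.Build _ _ _ _ f lf).
have cf : continuous f.
  apply: (linear_bounded_continuous F).1; apply/linear_boundedP.
  near=> r => x; have Mr : M <= r by near: r; apply: nbhs_pinfty_ge; exact: num_real.
  have le_r y : F y <= r * `|y|.
    by apply: le_trans (fM y) _; rewrite ler_wpM2r.
  by rewrite ler_norml lerNl le_r andbT -[- _]linearN -[`|x|]normrN le_r.
suff fP : f \in @continuous_linear R B by exists (DualSpace fP).
by rewrite inE.
Unshelve. all: by end_near. Qed.

Lemma sublinear_scale_norm (M : R) : 0 <= M -> sublinear (fun x => M * `|x|).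
Proof.
move=> M0; split=> [x y|a x a0]; first by rewrite -mulrDr ler_wpM2l ?ler_normD.
by rewrite normrZ ger0_norm// mulrCA.
Qed.

(** The norm of [L] is at most 1 instead of equal to 1, so that [x = 0] is allowed. *)
Definition norming L x := (forall y, ev L y <= `|y|) /\ ev L x = `|x|.

(** The last hypothesis is Birkhoff-James orthogonality. It says that the assignment of [a * |x|] to
    [a *: x + z], for [0 <= a], is dominated by the norm. The extension vanishes on [Z] because [Z]
    contains opposites. *)
Lemma norming_orthogonal x (Z : set B) : Z 0 ->
  (forall u v, Z u -> Z v -> Z (u + v)) -> (forall a u, Z u -> Z (a *: u)) ->
  (forall z, Z z -> `|x| <= `|x + z|) ->
  exists2 L, norming L x & forall z, Z z -> ev L z = 0.
Proof.
move=> Z0 ZD ZZ xZ.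
pose G := [set w : B * R | exists a z, [/\ 0 <= a, Z z & w = (a *: x + z, a * `|x|)]].
have sq := sublinear_scale_norm ler01.
have [||||f [lf fle Gf]] := @hahn_banach R B _ G sq.
- by exists 0, 0; rewrite scale0r mul0r addr0.
- move=> _ _ _ _ [a [u [a0 Zu [-> ->]]]] [b [v [b0 Zv [-> ->]]]].
  exists (a + b), (u + v); split; [exact: addr_ge0|exact: ZD|].
  by rewrite addrACA -scalerDl mulrDl.
- move=> c _ _ c0 [a [u [a0 Zu [-> ->]]]]; exists (c * a), (c *: u).
  by split; [rewrite mulr_ge0// ltW|exact: ZZ|rewrite scalerDr scalerA mulrA].
- move=> _ _ [a [u [a0 Zu [-> ->]]]]; rewrite mul1r.
  move: a0; rewrite le_eqVlt => /predU1P[<-|a0]; first by rewrite mul0r.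
  have -> : a *: x + u = a *: (x + a^-1 *: u).
    by rewrite scalerDr scalerA divff ?gt_eqF// scale1r.
  by rewrite normrZ (gtr0_norm a0) ler_pM2l// xZ//; exact: ZZ.
have [L Lf] := dominated_linear_dual lf fle.
have LG a z : 0 <= a -> Z z -> a * `|x| <= ev L (a *: x + z).
  by move=> a0 Zz; rewrite Lf; apply: Gf; exists a, z.
have L1 y : ev L y <= `|y| by rewrite Lf -[leRHS]mul1r.
exists L; first split=> //.
  by apply/eqP; rewrite eq_le L1/=; have := LG 1 0 ler01 Z0; rewrite addr0 scale1r mul1r.
move=> z Zz; apply/eqP; rewrite eq_le; apply/andP; split.
  have := LG 0 (-1 *: z) (lexx _) (ZZ _ _ Zz).
  by rewrite scale0r mul0r add0r scaleN1r dualN oppr_ge0.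
by have := LG 0 z (lexx _) Zz; rewrite scale0r mul0r add0r.
Qed.

Lemma norming_exists x : exists L, norming L x.
Proof.
have [|||u ->|L Lx _] := @norming_orthogonal x [set 0] => //.
- by move=> u v /= -> ->; rewrite addr0.
- by move=> a u /= ->; rewrite scaler0.
- by rewrite addr0.
by exists L.
Qed.

Lemma norming_norm L x : x != 0 -> norming L x -> `|L| = 1.
Proof.
move=> x0 [L1 Lx]; apply/eqP; rewrite eq_le; apply/andP; split.
  by apply: dual_norm_le_bound => // y; rewrite mul1r.
have := dual_le_norm L x; rewrite Lx -{1}[`|x|]mul1r ler_pM2r//.
by rewrite normr_gt0.
Qed.

Lemma norming_scale L x c : 0 <= c -> norming L x -> norming L (c *: x).
Proof. by move=> c0 [L1 Lx]; split=> //; rewrite dualZ Lx normrZ ger0_norm. Qed.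

Lemma norming_bound L x y : norming L x -> `|ev L y| <= `|y|.
Proof.
by case=> L1 _; rewrite ler_norml lerNl -dualN L1 andbT -[`|y|]normrN L1.
Qed.

End dual_facts.

(** * Monotonicity along rays *)

Section radial_monotonicity.
Context {R : realType} {B : normedModType R}.
Variable Omega : B -> R.

Definition tangentially_monotone : Prop :=
  forall (L : dual_space B) (x y : B), x != 0 -> norming L x ->
    ev L y = `|x| -> Omega x <= Omega y.

(** Convexity of the norm: a minimum near [w] on the line is a global one. *)
Lemma norm_line_min (w d : B) :
  (forall c, exists2 s, 0 < s <= 1 & `|w| <= `|w + (s * c) *: d|) ->
  forall c, `|w| <= `|w + c *: d|.
Proof.
move=> wd c; have [s /andP[s0 s1]] := wd c.
have -> : w + (s * c) *: d = (1 - s) *: w + s *: (w + c *: d).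
  by rewrite scalerDr scalerA addrA -scalerDl subrK scale1r.
move=> /le_trans-/(_ _ (ler_normD _ _)).
rewrite !normrZ (gtr0_norm s0) ger0_norm ?subr_ge0//.
rewrite mulrBl mul1r -addrA lerDl addrC subr_ge0 ler_pM2l//.
Qed.

Hypothesis Omega_tangent : tangentially_monotone.

(* With [k = 1 - 1 / mu], a point [w = v + T z] is found at which the affine
   function [u |-> N w * (1 + k (u - T) / T)] supports [N u = `|v + u z|]; this
   says that the line through [w] and [mu v] is tangent at [w]. *)
Lemma tangent_return (v z : B) (L0 : dual_space B) (mu : R) :
  v != 0 -> z != 0 -> norming L0 v -> ev L0 z = 0 -> 1 < mu ->
  exists2 T, 0 < T & forall u,
    `|v + T *: z| * (T + (1 - mu^-1) * (u - T)) <= T * `|v + u *: z|.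
Proof.
move=> v0 z0 L0v L0z mu1; set k := 1 - mu^-1.
have mu0 : 0 < mu by rewrite (lt_trans ltr01).
have k0 : 0 < k by rewrite subr_gt0 invf_lt1.
have vp : 0 < `|v| by rewrite normr_gt0.
have zp : 0 < `|z| by rewrite normr_gt0.
pose N u := `|v + u *: z|.
have Nge u : `|v| <= N u.
  have := L0v.1 (v + u *: z).
  by rewrite dualD dualZ L0z mulr0 addr0 L0v.2.
have [L Lp] := choice (fun u => norming_exists (v + u *: z)).
pose m u := ev (L u) z.
have NE u : N u = ev (L u) v + u * m u by rewrite /N -(Lp u).2 dualD dualZ.
have Nsup s u : N s + m s * (u - s) <= N u.
  have := (Lp s).1 (v + u *: z); rewrite dualD dualZ NE -/(m s) -/(N u); lra.
(* [m] is a subgradient of [N], and [S] collects the parameters with logarithmic slope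
   [t * m t / N t] at most [k]. The tangent point is where this slope crosses [k], hence the
   supremum of [S]. *)
pose S := [set t | 0 < t /\ t * m t <= k * N t].
have mz u : m u <= `|z| by exact: (Lp u).1.
have St0 : S (k * `|v| / `|z|).
  have t0 : 0 < k * `|v| / `|z| by rewrite divr_gt0// mulr_gt0.
  split=> //; apply: (@le_trans _ _ (k * `|v| / `|z| * `|z|)).
    by rewrite ler_pM2l.
  by rewrite divfK ?gt_eqF// ler_pM2l.
have Sub t : S t -> t <= (mu + 1) * `|v| / `|z|.
  move=> [t0 tk].
  (* By [NE], membership in [S] gives [(1 - k) * N t <= |v|], and [1 - k] is the inverse of [mu]. *)
  have h1 : N t <= mu * `|v|.
    rewrite -ler_pdivrMl//; have := (Lp t).1 v; have := NE t; move: tk.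
    rewrite {1}/k; lra.
  have h2 : t * `|z| <= N t + `|v|.
    rewrite -[X in X * _](gtr0_norm t0) -normrZ.
    have -> : t *: z = (v + t *: z) - v by rewrite addrAC subrr add0r.
    exact: ler_normB.
  by rewrite ler_pdivlMr//; lra.
have hS : has_sup S by split; [exists (k * `|v| / `|z|)|exists ((mu + 1) * `|v| / `|z|)].
set T := sup S.
have T0 : 0 < T by apply: lt_le_trans St0.1 _; apply: ub_le_sup; case: hS.
(* The subgradient [m] need not be continuous, but [g] is: a failure at [T] would persist nearby. It
   is excluded at points of [S] close to [T] if [u < T], and at points just above [T], outside [S],
   if [T < u]. *)
exists T => // u; rewrite leNgt; apply/negP; rewrite -subr_gt0 => gT.
pose g s := N s * (s + k * (u - s)) - s * N u.
have gc : g s @[s --> T] --> g T.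
  apply: cvgB; last by apply: cvgMr_tmp; exact: cvg_id.
  apply: cvgM.
    apply: cvg_norm; apply: cvgD; first exact: cvg_cst.
    by apply: cvgZr_tmp; exact: cvg_id.
  apply: cvgD; first exact: cvg_id.
  by apply: cvgMl_tmp; apply: cvgB; [exact: cvg_cst|exact: cvg_id].
have /nbhs_ballP[e e0 gpos] : \forall s \near T, 0 < g s.
  by apply: (cvgr_gt _ gc).
have gS s : S s -> u <= s -> g s <= 0.
  move=> [s0 sk] us; have := Nsup s u; rewrite -(ler_pM2l s0) /g.
  have : s * m s * (s - u) <= k * N s * (s - u) by rewrite ler_wpM2r// subr_ge0.
  nra.
have gnS s : 0 < s -> ~ S s -> s <= u -> g s <= 0.
  move=> s0 nSs su; have := Nsup s u; rewrite -(ler_pM2l s0) /g.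
  have /ltW sk : k * N s < s * m s by rewrite ltNge; apply/negP => ?; apply: nSs.
  have : k * N s * (u - s) <= s * m s * (u - s) by rewrite ler_wpM2r// subr_ge0.
  nra.
have [uT|Tu|uT] := ltgtP u T.
- have d0 : 0 < Num.min e (T - u) by rewrite lt_min e0 subr_gt0.
  have [s Ss sT] := sup_adherent d0 hS.
  have sleT : s <= T by apply: ub_le_sup; case: hS.
  move: sT; rewrite -/T ltrBlDr -ltrBlDl lt_min => /andP[h1 h2].
  have /gpos : ball T e s by rewrite /ball/= ger0_norm; lra.
  by apply/negP; rewrite -leNgt; apply: gS => //; lra.
- pose s := T + Num.min e (u - T) / 2.
  have d0 : 0 < Num.min e (u - T) by rewrite lt_min e0 subr_gt0.
  have : Num.min e (u - T) <= e by rewrite ge_min lexx.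
  have : Num.min e (u - T) <= u - T by rewrite ge_min lexx orbT.
  move=> h1 h2.
  have /gpos : ball T e s by rewrite /ball/= ler0_norm /s; lra.
  apply/negP; rewrite -leNgt; apply: gnS; rewrite /s; try lra.
  by move=> Ss; have : s <= T; [apply: ub_le_sup; case: hS|rewrite /s; lra].
- by move: gT; rewrite uT subrr mulr0 addr0 mulrC subrr ltxx.
Qed.

(** Two tangential steps suffice, [v ~> w ~> mu *: v], with [w = v + T *: z] taken from
    [tangent_return]. *)
Lemma monotone_along_ray_aux (v z : B) (L0 : dual_space B) (mu : R) :
  v != 0 -> z != 0 -> norming L0 v -> ev L0 z = 0 -> 1 < mu ->
  Omega v <= Omega (mu *: v).
Proof.
move=> v0 z0 L0v L0z mu1.
have [T T0 supp] := tangent_return v0 z0 L0v L0z mu1.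
set w := v + T *: z in supp; set d := mu *: v - w.
have mu0 : 0 < mu by rewrite (lt_trans ltr01).
have vw : Omega v <= Omega w.
  by apply: (Omega_tangent v0 L0v); rewrite dualD dualZ L0z mulr0 addr0 L0v.2.
have w0 : w != 0.
  have := L0v.1 w; rewrite dualD dualZ L0z mulr0 addr0 L0v.2 -!normr_gt0.
  by apply: lt_le_trans; rewrite normr_gt0.
(* Here [w + c *: d] is [a] times [v + u *: z] with [u = (1 - c) * T / a], and the support
   inequality at this [u] is exactly the claim. *)
have pos c : 0 < 1 + c * (mu - 1) -> `|w| <= `|w + c *: d|.
  set a := 1 + _ => a0.
  have -> : w + c *: d = a *: (v + ((1 - c) * T / a) *: z).
    rewrite [RHS]scalerDr [X in _ = _ + X]scalerA [a * _]mulrC divfK ?gt_eqF//.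
    have -> : a = (1 - c) + c * mu by rewrite /a; ring.
    rewrite [in RHS]scalerDl [in RHS]addrAC -(scalerA (1 - c)) -(scalerDr (1 - c)) -/w.
    rewrite [in RHS]scalerBl scale1r -[RHS]addrA /d; congr (_ + _).
    by rewrite [RHS]addrC scalerBr scalerA.
  rewrite normrZ (gtr0_norm a0).
  have := supp ((1 - c) * T / a).
  have -> : T + (1 - mu^-1) * ((1 - c) * T / a - T) = T / a.
    by rewrite /a; field; rewrite !gt_eqF.
  by rewrite mulrCA ler_pM2l// ler_pdivrMr// mulrC.
have orth c : `|w| <= `|w + c *: d|.
  apply: norm_line_min c => c.
  have q1 : 0 <= `|c| * (mu - 1) by rewrite mulr_ge0// subr_ge0 ltW.
  have q0 : 0 < 1 + `|c| * (mu - 1) by lra.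
  (* This factor keeps the absolute value of [s * c * (mu - 1)] below 1/2, so that [pos] applies. *)
  exists (2 * (1 + `|c| * (mu - 1)))^-1.
    rewrite invr_gt0 mulr_gt0//= invf_le1 ?mulr_gt0//; lra.
  apply: pos.
  have -> : 1 + (2 * (1 + `|c| * (mu - 1)))^-1 * c * (mu - 1) =
    (2 * (1 + `|c| * (mu - 1)) + c * (mu - 1)) / (2 * (1 + `|c| * (mu - 1))).
    by field; rewrite gt_eqF.
  rewrite divr_gt0 ?mulr_gt0//.
  have : - `|c| * (mu - 1) <= c * (mu - 1).
    by apply: ler_wpM2r; [lra|rewrite lerNl -normrN ler_norm].
  by lra.
have [|||_ [c _ <-]|L Lw Ld] := @norming_orthogonal _ _ w (range (fun c => c *: d)).
- by exists 0; rewrite // scale0r.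
- by move=> _ _ [a _ <-] [b _ <-]; exists (a + b); rewrite // scalerDl.
- by move=> a _ [b _ <-]; exists (a * b); rewrite // scalerA.
- exact: orth.
apply: (le_trans vw); apply: (Omega_tangent w0 Lw).
have := Ld d; rewrite dualB Lw.2 => /(_ _)/eqP; rewrite subr_eq0 => H.
by apply/eqP/H; exists 1; rewrite // scale1r.
Qed.

End radial_monotonicity.

(** * Monotonicity in the norm *)

Section norm_monotonicity.
Context {R : realType} {B : normedModType R}.
Variable Omega : B -> R.
Hypothesis Omega_tangent : tangentially_monotone Omega.

(* One walks from the direction of [f] to that of [g] in [n] steps, each along
   a tangent. With [L] and [L'] norming the endpoints [p], [p'] of a step and
   [d = g - f], the radius grows by [O((ev L' d - ev L d) / n)], and these
   increments telescope. *)
Lemma tangent_walk (f g : B) (eps : R) : 0 < eps ->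
  (forall s, 0 <= s <= 1 -> f + s *: (g - f) != 0) ->
  exists c, [/\ 0 < c, `|c *: g| <= `|f| + eps & Omega f <= Omega (c *: g)].
Proof.
move=> eps0 fg0; set d := g - f in fg0 *; pose p s := f + s *: d.
pose N s := `|p s|.
have [a0 a01 amin] : exists2 a, a \in `[0, 1]%R & forall t, t \in `[0, 1]%R -> N a <= N t.
  apply: EVT_min => //; apply: continuous_subspaceT => s.
  apply: cvg_norm; apply: cvgD; first exact: cvg_cst.
  by apply: cvgZr_tmp; exact: cvg_id.
set k := N a0 in amin.
have k0 : 0 < k by rewrite normr_gt0 fg0//; move: a01; rewrite in_itv.
set D := `|d|; have D0 : 0 <= D by exact: normr_ge0.
set K := `|f| + eps; have K0 : 0 < K by rewrite ltr_wpDl.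
(* With [h = 1 / n], the first bound keeps the denominators [N s + m s * h] above [k / 2]; the
   second keeps the total growth [2 * K * h / k * (2 * D)] within [eps]. *)
have [n [n0 nD nK]] : exists n : nat, [/\ (0 < n)%N, D <= k / 2 * n%:R &
    4 * D * K <= k * eps * n%:R].
  pose M := Num.max (D / (k / 2)) (4 * D * K / (k * eps)).
  have M0 : 0 <= M by rewrite le_max divr_ge0// ltW// divr_gt0.
  exists (Num.bound M); have /ltW Mn := archi_boundP M0.
  split.
  - by rewrite -(ltr_nat R) (le_lt_trans M0)// archi_boundP.
  - rewrite mulrC -ler_pdivrMr ?divr_gt0//; apply: le_trans Mn.
    by rewrite le_max lexx.
  - rewrite mulrC [leRHS]mulrC -ler_pdivrMr ?mulr_gt0//; apply: le_trans Mn.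
    by rewrite [K * _]mulrC le_max lexx orbT.
have nR : 0 < n%:R :> R by rewrite ltr0n.
pose h : R := n%:R^-1.
have h0 : 0 < h by rewrite invr_gt0.
have hn : n%:R * h = 1 by rewrite divff// gt_eqF.
have hD : h * D <= k / 2.
  by rewrite /h -ler_pdivlMl ?invr_gt0// invrK mulrC.
have hK : 4 * D * K * h <= k * eps.
  by rewrite /h ler_pdivrMr.
have [L Lp] := choice (fun s => norming_exists (p s)).
pose m s := ev (L s) d.
have mD s : `|m s| <= D by exact: norming_bound (Lp s).
have sup s t : N s + m s * (t - s) <= N t.
  have := (Lp s).1 (p t); have := (Lp s).2.
  by rewrite /p !dualD !dualZ -/(m s) -/(p s) -/(p t) -/(N s) -/(N t); lra.
have dom i : (i <= n)%N -> 0 <= i%:R * h <= 1.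
  by move=> ni; rewrite mulr_ge0 ?(ltW h0)//= -[leRHS]hn ler_pM2r// ler_nat.
have Nk i : (i <= n)%N -> k <= N (i%:R * h).
  by move=> /dom ni; apply: amin; rewrite in_itv.
have walk (i : nat) : (i <= n)%N -> exists c, [/\ 0 < c,
    c * N (i%:R * h) <= `|f| + 2 * K * h / k * (m (i%:R * h) - m 0)
    & Omega f <= Omega (c *: p (i%:R * h))].
  elim: i => [_|i IH ni].
    exists 1; rewrite mul0r subrr mulr0 addr0 mul1r scale1r /N /p scale0r addr0.
    by split.
  have [c [c0 cN cO]] := IH (ltnW ni).
  have {IH} Ni := Nk _ (ltnW ni).
  set s := i%:R * h in cN cO Ni; set s' := i.+1%:R * h.
  have Ns0 : 0 < N s by exact: lt_le_trans Ni.
  have ss' : s' - s = h by rewrite /s' /s -natr1; lra.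
  have u1 := sup s s'; have u2 := sup s' s.
  have ss'' : s - s' = - h by lra.
  rewrite ss' in u1; rewrite ss'' in u2.
  have ms := mD s; have ms' := mD s'; have m0 := mD 0.
  have mh : - (k / 2) <= m s * h.
    have : `|m s * h| <= k / 2.
      by rewrite normrM (gtr0_norm h0); apply: le_trans hD; rewrite mulrC ler_pM2l.
    by rewrite ler_norml => /andP[].
  have den : k / 2 <= N s + m s * h by lra.
  have den0 : 0 < N s + m s * h by apply: lt_le_trans den; rewrite divr_gt0.
  (* Adding [u1] and [u2] shows that subgradients increase along the segment. *)
  have mm : 0 <= m s' - m s.
    by rewrite -(pmulr_lge0 _ h0); lra.
  have m0' : m s - m 0 <= 2 * D.
    by move: ms m0; rewrite !ler_norml => /andP[_ ?] /andP[? _]; lra.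
  (* The telescoped sum bounds the radius so far by [K], which makes the growth estimate uniform
     over the steps. *)
  have cK : c * N s <= K.
    apply: (le_trans cN); rewrite lerD2l.
    apply: (@le_trans _ _ (2 * K * h / k * (2 * D))).
      by rewrite ler_pM2l// divr_gt0// !mulr_gt0.
    by rewrite mulrAC ler_pdivrMr//; lra.
  (* Since [ev (L s) (p s') = N s + m s * h], this coefficient puts the next point on the hyperplane
     tangent at [c *: p s]. *)
  exists (c * N s / (N s + m s * h)); split.
  - by rewrite divr_gt0// mulr_gt0.
  (* By [u2], [N s'] exceeds [N s + m s * h] by at most [(m s' - m s) * h]. *)
  - apply: (@le_trans _ _ (c * N s * (1 + (m s' - m s) * h / (k / 2)))).
      rewrite mulrAC -mulrA ler_pM2l ?mulr_gt0//.
      rewrite ler_pdivrMr//.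
      have -> : (1 + (m s' - m s) * h / (k / 2)) * (N s + m s * h) =
        N s + m s * h + (m s' - m s) * h * ((N s + m s * h) / (k / 2)).
        by field; rewrite gt_eqF.
      have : (m s' - m s) * h <= (m s' - m s) * h * ((N s + m s * h) / (k / 2)).
        rewrite ler_peMr// ?mulr_ge0 ?(ltW h0)//.
        by rewrite ler_pdivlMr ?mul1r// divr_gt0.
      lra.
    rewrite mulrDr mulr1.
    have inc0 : 0 <= (m s' - m s) * h / (k / 2).
      by apply: divr_ge0; [apply: mulr_ge0 => //; exact: ltW|lra].
    have incK := ler_wpM2r inc0 cK.
    have incE : K * ((m s' - m s) * h / (k / 2)) = 2 * K * h / k * (m s' - m s).
      by field; rewrite gt_eqF.
    lra.
  - apply: (le_trans cO); apply: (Omega_tangent (L := L s)).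
    + by rewrite scaler_eq0 negb_or (gt_eqF c0)/= -normr_gt0.
    + by apply: norming_scale => //; exact: ltW.
    + have -> : p s' = p s + h *: d by rewrite /p -ss' -addrA -scalerDl subrKC.
      rewrite dualZ dualD (Lp s).2 dualZ normrZ (gtr0_norm c0) -/(N s) -/(m s).
      by rewrite [h * _]mulrC divfK// gt_eqF.
have [c [c0 cN cO]] := walk n (leqnn n).
move: cN cO; rewrite hn => cN cO.
have p1 : p 1 = g by rewrite /p scale1r subrKC.
rewrite /N p1 in cN; rewrite p1 in cO.
exists c; split=> //; rewrite normrZ (gtr0_norm c0); apply: (le_trans cN).
rewrite lerD2l; apply: (@le_trans _ _ (2 * K * h / k * (2 * D))).
  rewrite ler_pM2l; last by rewrite divr_gt0// !mulr_gt0.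
  by have := mD 1; have := mD 0; rewrite !ler_norml => /andP[? _] /andP[_ ?]; lra.
by rewrite mulrAC ler_pdivrMr//; lra.
Qed.

Hypothesis dim_B : ~ one_dimensional B.

Lemma ex_independent (e : B) : e != 0 -> exists x, forall a, x != a *: e.
Proof.
move=> e0; apply: contrapT => nx; apply: dim_B; exists e => // x.
apply: contrapT => na; apply: nx; exists x => a; apply/eqP => xa.
by apply: na; exists a.
Qed.

Lemma monotone_along_ray (v : B) (mu : R) : v != 0 -> 1 <= mu ->
  Omega v <= Omega (mu *: v).
Proof.
move=> v0; rewrite le_eqVlt => /predU1P[<-|mu1]; first by rewrite scale1r.
have [x xv] := ex_independent v0; have [L Lv] := norming_exists v.
have nv : `|v| != 0 by rewrite normr_eq0.
apply: (monotone_along_ray_aux Omega_tangent (z := x - (ev L x / `|v|) *: v) v0 _ Lv) => //.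
  by rewrite subr_eq0.
by rewrite dualB dualZ Lv.2 divfK// subrr.
Qed.

(** With the gap between the norms as [eps], the walk ends at [c *: g] with [c <= 1], and a dilation
    leads on to [g]. *)
Lemma norm_monotone_segment (f g : B) : `|f| < `|g| ->
  (forall s, 0 <= s <= 1 -> f + s *: (g - f) != 0) -> Omega f <= Omega g.
Proof.
move=> fg fg0; have eps0 : 0 < `|g| - `|f| by rewrite subr_gt0.
have [c [c0 cg fc]] := tangent_walk eps0 fg0.
have g0 : 0 < `|g| by rewrite (le_lt_trans _ fg).
have c1 : c <= 1.
  by move: cg; rewrite subrKC normrZ (gtr0_norm c0) -{2}[`|g|]mul1r ler_pM2r.
have cg0 : c *: g != 0 by rewrite scaler_eq0 negb_or (gt_eqF c0) -normr_gt0.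
have := @monotone_along_ray (c *: g) c^-1 cg0.
rewrite scalerA mulVf ?gt_eqF// scale1r => H.
by apply: (le_trans fc); apply: H; rewrite invf_ge1.
Qed.

(** If the segment from [f] to [g] meets 0, then [g] is a multiple of [f]. A detour through a vector
    [w] off their line, with norm halfway between, avoids 0. *)
Lemma norm_monotone (f g : B) : (forall x, Omega 0 <= Omega x) ->
  `|f| < `|g| -> Omega f <= Omega g.
Proof.
move=> O0 fg; have [->//|f0] := eqVneq f 0.
have g0 : g != 0 by rewrite -normr_gt0 (le_lt_trans _ fg).
have [fg0|] := pselect (forall s, 0 <= s <= 1 -> f + s *: (g - f) != 0).
  exact: norm_monotone_segment.
move=> /existsNP[s /not_implyP[s01 /negP/negPn/eqP fgs]].
have seg a b : f + a *: (b - f) = (1 - a) *: f + a *: b.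
  by rewrite scalerBr scalerBl scale1r addrCA [RHS]addrC.
have s0 : s != 0.
  by apply: contra_neq f0 => s0; move: fgs; rewrite s0 scale0r addr0.
have [x xf] := ex_independent f0.
have gE : g = ((s - 1) / s) *: f.
  move: fgs; rewrite seg => /eqP; rewrite addr_eq0 => /eqP fs.
  rewrite mulrC -scalerA -[s - 1]opprB scaleNr fs opprK scalerA mulVf//.
  by rewrite scale1r.
have x0 : x != 0 by have := xf 0; rewrite scale0r.
have nx : 0 < `|x| by rewrite normr_gt0.
pose r := (`|f| + `|g|) / 2.
have fr : `|f| < r by rewrite /r; lra.
have rg : r < `|g| by rewrite /r; lra.
have r0 : 0 < r by rewrite (le_lt_trans _ fr).
pose w := (r / `|x|) *: x.
have wr : `|w| = r.
  by rewrite normrZ (gtr0_norm (divr_gt0 r0 nx)); field; rewrite gt_eqF.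
have wf a : w != a *: f.
  apply/eqP => wa; have := xf (`|x| / r * a); rewrite -scalerA -wa /w scalerA.
  by rewrite mulrA divfK ?gt_eqF// divff ?gt_eqF// scale1r eqxx.
have indep a b : a *: f + b *: w = 0 -> b = 0.
  move=> /eqP; rewrite addrC addr_eq0 => /eqP bw; apply/eqP/negPn/negP => b0.
  have := wf (b^-1 * - a); rewrite -scalerA scaleNr -bw scalerA mulVf//.
  by rewrite scale1r eqxx.
apply: (@le_trans _ _ (Omega w)); apply: norm_monotone_segment; rewrite ?wr//.
  move=> t _; apply/eqP; rewrite seg => H; have t0 := indep _ _ H.
  by move: H; rewrite t0 subr0 scale0r addr0 scale1r; exact/eqP.
move=> t _; apply/eqP => H; have : (t * ((s - 1) / s)) *: f + (1 - t) *: w = 0.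
  by rewrite -H -scalerA -gE scalerBr scalerBl scale1r addrCA.
move=> /[dup] /indep/eqP; rewrite subr_eq0 => /eqP <-.
by rewrite subrr scale0r addr0 mul1r -gE; exact/eqP.
Qed.

End norm_monotonicity.

(** * Consequences of admissibility *)

Section admissibility.
Context {R : realType} {B : normedModType R}.
Hypothesis convex_B : strictly_convex_space B.

(** Otherwise the midpoint of the two normalised vectors has norm less than 1, while [L] takes the
    value 1 there. *)
Lemma norming_unique (L : dual_space B) (x y : B) :
  norming L x -> norming L y -> `|x| = `|y| -> x = y.
Proof.
move=> [L1 Lx] [_ Ly] xy; apply/eqP/negPn/negP => nxy.
have [x0|] := eqVneq x 0.
  by move: xy nxy; rewrite x0 normr0 => /esym/normr0_eq0 ->; rewrite eqxx.
rewrite -normr_gt0 => x0; have nx : `|x| != 0 by rewrite gt_eqF.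
have unit (z : B) : `|z| = `|x| -> `| (`|x|^-1 *: z) | = 1.
  by move=> zx; rewrite normrZ normfV normr_id zx mulVf.
have nxy' : `|x|^-1 *: x != `|x|^-1 *: y.
  apply: contra nxy => /eqP /(congr1 (fun z => `|x| *: z)).
  by rewrite !scalerA divff// !scale1r => ->.
have h01 : 0 < (2^-1 : R) < 1 by apply/andP; split; lra.
have : `|2^-1 *: (`|x|^-1 *: x) + (1 - 2^-1) *: (`|x|^-1 *: y)| < 1.
  by apply: convex_B => //; exact: unit.
rewrite ltNge => /negP; apply; apply: le_trans (L1 _).
by rewrite dualD !dualZ Lx Ly -xy mulVf// !mulr1 addrCA subrr addr0.
Qed.

(** Without constraints the representer is the empty sum, and 0 belongs to the duality map only at
    0. *)
Lemma admissible_min0 (Y : set R) (Omega : B -> R) (f : B) :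
  admissible Y Omega -> Omega 0 <= Omega f.
Proof.
move=> adm.
have [||g [_ gmin] [c [_ cg]]] := adm 0%N (fun=> 0) (fun=> 0).
- by case.
- by exists 0; case.
have g0 : g = 0 by apply/normr0_eq0; rewrite -cg big_ord0 normr0.
by rewrite -g0; apply: gmin; case.
Qed.

(** Rescaling [L] to [K] turns the tangent hyperplane into the constraint with datum [y], which is
    possible because [y] is nonzero. The represented solution is normed by [L] and has the norm of
    [x], so it is [x]. *)
Lemma admissible_tangentially_monotone (Y : set R) (Omega : B -> R) :
  (exists2 y, Y y & y != 0) -> admissible Y Omega -> tangentially_monotone Omega.
Proof.
move=> [y Yy y0] adm L x x' x0 Lx Lx'.
have xp : 0 < `|x| by rewrite normr_gt0.
have nx : `|x| != 0 by rewrite gt_eqF.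
pose K : dual_space B := (y / `|x|) *: L.
have KE z : ev K z = y / `|x| * ev L z by [].
have Kx z : ev L z = `|x| -> interpolates (fun _ : 'I_1 => K) (fun=> y) z.
  move=> Lz i; suff : ev K z = y by [].
  by rewrite KE Lz divfK.
have [||f [fK fmin] [c [cf1 cf2]]] := adm 1%N (fun=> K) (fun=> y).
- by [].
- by exists x; apply: Kx; rewrite Lx.2.
have Lf : ev L f = `|x|.
  have : ev K f = y := fK ord0.
  rewrite KE => /(congr1 (fun t => t / y * `|x|)).
  by rewrite divff// mul1r => <-; field; rewrite y0 nx.
suff -> : x = f by apply: fmin; exact: Kx.
have fn : f != 0 by apply: contra_eq_neq Lf => ->; rewrite dual0 eq_sym.
have fp : 0 < `|f| by rewrite normr_gt0.
rewrite big_ord1 in cf1 cf2; set a := c ord0 in cf1 cf2.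
have nK : `|a *: K| = `|a * (y / `|x|)|.
  by rewrite /K scalerA normrZ (norming_norm x0 Lx) mulr1.
have af : a * (y / `|x|) * `|x| = `|f| * `|f|.
  have : ev (a *: K) f = `|f| * `|f| by rewrite -{1}cf2; exact: cf1.
  by rewrite dual_scaleE KE Lf => <-; rewrite -mulrA.
(* Positivity identifies this coefficient with the norm of [a *: K], which is the norm of [f];
   cancelling it in [af] leaves equal norms. *)
have a0 : 0 < a * (y / `|x|) by rewrite -(pmulr_lgt0 _ xp) af mulr_gt0.
have xf : `|x| = `|f|.
  by move: af; rewrite -{1}cf2 nK (gtr0_norm a0) => /(mulfI (lt0r_neq0 a0)).
by apply: (norming_unique Lx) => //; split; [exact: Lx.1|rewrite Lf].
Qed.

End admissibility.

(** * Interpolants of minimal norm *)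

Section min_norm_interpolation.
Context {R : realType} {B : normedModType R}.

(** By induction: a multiple of [L ord0] is subtracted from [f] so that the difference vanishes on
    the common kernel of the other functionals. *)
Lemma kernel_span (m : nat) (L : 'I_m -> dual_space B) (f : dual_space B) :
  (forall x, (forall i, ev (L i) x = 0) -> ev f x = 0) ->
  exists c : 'I_m -> R, f = \sum_(i < m) c i *: L i.
Proof.
elim: m L f => [|m IH] L f Lf.
  exists (fun=> 0); rewrite big_ord0; apply/val_inj/funext => x.
  by apply: Lf; case.
pose L' i := L (lift ord0 i); pose g := L ord0.
have [c cf] : exists c, forall x, (forall i, ev (L' i) x = 0) -> ev (f - c *: g) x = 0.
  have [[x0 [Lx0 gx0]]|nx0] := pselect (exists x, (forall i, ev (L' i) x = 0) /\ ev g x != 0).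
    exists (ev f x0 / ev g x0) => x Lx.
    suff : ev f (x - (ev g x / ev g x0) *: x0) = 0.
      rewrite dualB dualZ => fx.
      have -> : ev (f - (ev f x0 / ev g x0) *: g) x =
        ev f x - ev f x0 / ev g x0 * ev g x by [].
      by rewrite -fx; field.
    apply: Lf => i; have [->|[j ->]] : i = ord0 \/ exists j, i = lift ord0 j.
      by case: (unliftP ord0 i) => [j|] ->; [right; exists j|left].
      by rewrite dualB dualZ -/g divfK// subrr.
    by rewrite dualB dualZ Lx Lx0 mulr0 subrr.
  exists 0 => x Lx; rewrite scale0r subr0; apply: Lf => i.
  case: (unliftP ord0 i) => [j|] ->; first exact: Lx.
  by apply/eqP/negPn/negP => gx; apply: nx0; exists x.
have [c' fE] := IH L' _ cf.
exists (fun i => if unlift ord0 i is Some j then c' j else c).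
rewrite big_ord_recl unlift_none; under eq_bigr do rewrite liftK.
by rewrite -/g -fE addrC subrK.
Qed.

(** Hahn-Banach on the dual space extends the assignment of [y i] to [L i] with bound [rho], the
    infimum of the norms of interpolants. Reflexivity turns the extension into a point of norm at
    most [rho]. *)
Lemma min_norm_interpolant (m : nat) (L : 'I_m -> dual_space B) (y : 'I_m -> R) :
  reflexive_space B -> interpolates L y !=set0 ->
  exists2 f, interpolates L y f & forall g, interpolates L y g -> `|f| <= `|g|.
Proof.
move=> refl [g0 Lg0]; pose A := [set `|g| | g in interpolates L y].
have hA : has_inf A.
  by split; [exists `|g0|, g0|exists 0 => _ [g _ <-]].
pose rho := inf A.
have rho0 : 0 <= rho by apply: lb_le_inf; [case: hA|move=> _ [g _ <-]].
pose G := [set w : dual_space B * R |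
  exists c : 'I_m -> R, w = (\sum_i c i *: L i, \sum_i c i * y i)].
have evc (c : 'I_m -> R) g : ev (\sum_i c i *: L i) g = \sum_i c i * ev (L i) g.
  by rewrite dual_sumE.
have [||||phi [lphi phile Gphi]] :=
    @hahn_banach R (dual_space B) _ G (sublinear_scale_norm rho0).
- by exists (fun=> 0); rewrite !big1// => i _; rewrite ?scale0r ?mul0r.
- move=> _ _ _ _ [c [-> ->]] [c' [-> ->]]; exists (fun i => c i + c' i).
  by rewrite -!big_split; congr pair; apply: eq_bigr => i _; rewrite ?scalerDl ?mulrDl.
- move=> a _ _ a0 [c [-> ->]]; exists (fun i => a * c i).
  by rewrite scaler_sumr mulr_sumr; congr pair; apply: eq_bigr => i _;
    rewrite ?scalerA ?mulrA.
- move=> _ _ [c [-> ->]]; set u := \sum_i c i *: L i.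
  have ug g : interpolates L y g -> \sum_i c i * y i <= `|u| * `|g|.
    move=> Lg; have := dual_le_norm u g; rewrite evc; apply: le_trans.
    by apply: ler_sum => i _; rewrite -(Lg i).
  have [u0|] := eqVneq `|u| 0.
    by rewrite u0 mulr0; have := ug _ Lg0; rewrite u0 mul0r.
  move=> u0; have up : 0 < `|u| by rewrite lt_def u0 normr_ge0.
  rewrite -ler_pdivrMr//; apply: lb_le_inf; first by case: hA.
  by move=> _ [g Lg <-]; rewrite ler_pdivrMr// mulrC ug.
have [Phi PhiE] := dominated_linear_dual lphi phile.
have [x xE] := refl Phi.
have evx K : ev K x = phi K by rewrite /ev -xE -PhiE.
exists x.
  (* The extension yields only an inequality; tested with the residuals as coefficients, it bounds
     their sum of squares by 0. *)
  pose c i := y i - ev (L i) x.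
  have : \sum_i c i * y i <= phi (\sum_i c i *: L i) by apply: Gphi; exists c.
  rewrite -evx evc -subr_le0 -sumrB.
  under eq_bigr do rewrite -mulrBr -expr2.
  move=> c2 i; suff : c i = 0 by move/eqP; rewrite subr_eq0 => /eqP/esym.
  have /eqP : \sum_i c i ^+ 2 = 0.
    by apply/eqP; rewrite eq_le c2/= sumr_ge0// => j _; exact: sqr_ge0.
  rewrite psumr_eq0 => [/allP/(_ i)|j _]; last exact: sqr_ge0.
  by rewrite mem_index_enum sqrf_eq0 => /(_ isT)/eqP.
move=> g Lg; have [K Kx] := norming_exists x.
rewrite -Kx.2 evx; apply: (le_trans (phile K)).
apply: (@le_trans _ _ rho); last by apply: ge_inf; [case: hA|exists g].
rewrite ler_piMr//; apply: dual_norm_le_bound => // z.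
by rewrite mul1r; exact: Kx.1.
Qed.

Lemma min_norm_representer (m : nat) (L : 'I_m -> dual_space B) (y : 'I_m -> R)
    (f : B) : interpolates L y f ->
  (forall g, interpolates L y g -> `|f| <= `|g|) ->
  exists c : 'I_m -> R, duality_map f (\sum_(i < m) c i *: L i).
Proof.
move=> Lf fmin; have [->|f0] := eqVneq f 0.
  exists (fun=> 0); rewrite big1 => [|i _]; last by rewrite scale0r.
  by split; rewrite !normr0// mulr0.
have [|||z Zz|K Kf KZ] := @norming_orthogonal _ _ f [set z | forall i, ev (L i) z = 0].
- by move=> i; rewrite dual0.
- by move=> u v u0 v0 i; rewrite dualD u0 v0 addr0.
- by move=> a u u0 i; rewrite dualZ u0 mulr0.
- apply: fmin => i; have : ev (L i) (f + z) = y i; last by [].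
  by rewrite dualD Zz addr0; exact: Lf.
(* The factor [|f|] turns the norming functional, of norm 1, into an element of the duality map at
   [f]. *)
have [|c cE] := @kernel_span m L (`|f| *: K).
  by move=> z Zz; rewrite dual_scaleE KZ// mulr0.
have nK := norming_norm f0 Kf.
have nfK : `| `|f| *: K | = `|f| by rewrite normrZ normr_id nK mulr1.
exists c; rewrite -cE; split; last exact: nfK.
by rewrite nfK -[LHS]/(`|f| * ev K f) Kf.2.
Qed.

End min_norm_interpolation.

(** * One-sided limits of monotone functions *)

Section monotone_limits.
Context {R : realType} (h : R -> R).
Hypothesis h_mono : {in `[0, +oo[ &, nondecreasing_fun h}.

Let mono s t : 0 <= s -> s <= t -> h s <= h t.
Proof.
by move=> s0 st; apply: h_mono => //; rewrite in_itv/= andbT// (le_trans s0).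
Qed.

Lemma is_cvg_at_right r : 0 <= r -> cvg (h t @[t --> r^'+]).
Proof.
move=> r0; apply: nondecreasing_at_right_is_cvgr; near=> x.
  move=> s t; rewrite !in_itv/= => /andP[rs _] _ st.
  by apply: mono => //; rewrite (le_trans r0)// ltW.
exists (h r) => _ [s /= +] <-; rewrite in_itv/= => /andP[rs _].
by apply: mono => //; exact: ltW.
Unshelve. all: by end_near. Qed.

Lemma is_cvg_at_left r : 0 < r -> cvg (h t @[t --> r^'-]).
Proof.
move=> r0; apply: nondecreasing_at_left_is_cvgr; near=> x.
  move=> s t; rewrite !in_itv/= => /andP[xs _] _ st.
  by apply: mono => //; apply: le_trans (ltW xs); near: x; exact: nbhs_left_ge.
exists (h r) => _ [s /= +] <-; rewrite in_itv/= => /andP[xs sr].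
apply: mono; last exact: ltW.
by apply: le_trans (ltW xs); near: x; exact: nbhs_left_ge.
Unshelve. all: by end_near. Qed.

Lemma lim_at_right_le r s : 0 <= r -> r < s -> lim (h t @[t --> r^'+]) <= h s.
Proof.
move=> r0 rs; apply: limr_le; first exact: is_cvg_at_right.
near=> t; apply: mono.
  by apply: (le_trans r0); near: t; exact: nbhs_right_ge.
by near: t; exact: nbhs_right_le.
Unshelve. all: by end_near. Qed.

Lemma le_lim_at_left r s : 0 <= s -> s < r -> h s <= lim (h t @[t --> r^'-]).
Proof.
move=> s0 sr; apply: limr_ge; first by apply: is_cvg_at_left; exact: le_lt_trans sr.
near=> t; apply: mono => //; near: t; exact: nbhs_left_ge.
Unshelve. all: by end_near. Qed.

Lemma le_lim_at_right r a : 0 <= r -> (forall t, r < t -> a <= h t) ->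
  a <= lim (h t @[t --> r^'+]).
Proof.
move=> r0 ah; apply: limr_ge; first exact: is_cvg_at_right.
by near=> t; apply: ah; near: t; exact: nbhs_right_gt.
Unshelve. all: by end_near. Qed.

Lemma lim_at_left_le r a : 0 < r -> (forall t, 0 <= t -> t < r -> h t <= a) ->
  lim (h t @[t --> r^'-]) <= a.
Proof.
move=> r0 ah; apply: limr_le; first exact: is_cvg_at_left.
near=> t; apply: ah; near: t; [exact: nbhs_left_ge|exact: nbhs_left_lt].
Unshelve. all: by end_near. Qed.

Lemma jump_discontinuity_ge0_countable :
  countable [set r | 0 <= r /\ jump_discontinuity h r].
Proof.
pose D (n : nat) := if n is k.+1
  then [set r | r \in (`]0, k%:R[) /\ discontinuity h r] else [set 0].
apply: (@sub_countable _ _ _ (\bigcup_n D n)).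
  apply: subset_card_le => r [r0]; rewrite /jump_discontinuity.
  case: eqP => [-> _|/eqP rn0 hr]; first by exists 0%N.
  (* The successor matches the indexing of [D], whose index 0 is reserved for the radius 0. *)
  exists (Num.bound r).+1 => //; split=> //; rewrite in_itv/= lt_def rn0 r0/=.
  exact: archi_boundP.
apply: bigcup_countable => // -[|n] _; first exact: countable1.
apply: discontinuity_countable => s t.
rewrite !in_itv/= => /andP[s0 _] _; exact: mono.
Qed.

End monotone_limits.

(** * The two implications of the characterisation *)

Section characterisation.
Context {R : realType} {B : normedModType R}.
Variables (Y : set R) (Omega : B -> R).

Lemma radial_admissible (h : R -> R) (radii : set R) :
  reflexive_space B -> strictly_convex_space B ->
  {in `[0, +oo[ &, nondecreasing_fun h} ->
  (forall f, ~ radii `|f| -> Omega f = h `|f|) ->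
  (forall f, radii `|f| ->
    (0 < `|f| -> lim (h t @[t --> `|f|^'-]) <= Omega f) /\
    Omega f <= lim (h t @[t --> `|f|^'+])) ->
  admissible Y Omega.
Proof.
move=> refl conv h_mono Omega_h Omega_lim.
have ge0 (a : R) : 0 <= a -> a \in `[0, +oo[ by rewrite in_itv/= andbT.
(* On a sphere with radius in [radii], [Omega] is only enclosed by one-sided limits, so it is
   compared with [h] at strictly larger or smaller radii. *)
have up f s : `|f| < s -> Omega f <= h s.
  move=> fs; have [/Omega_lim[_ fl]|/Omega_h ->] := pselect (radii `|f|).
    by apply: (le_trans fl); exact: lim_at_right_le.
  apply: h_mono; [exact: ge0| |exact: ltW].
  by apply: ge0; apply: le_trans (ltW fs).
have down f s : 0 <= s -> s < `|f| -> h s <= Omega f.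
  move=> s0 sf; have [/Omega_lim[lf _]|/Omega_h ->] := pselect (radii `|f|).
    by apply: le_trans (lf (le_lt_trans s0 sf)); exact: le_lim_at_left.
  by apply: h_mono; [exact: ge0|exact: ge0|exact: ltW].
move=> m L y _ feasible.
have [f Lf fmin] := min_norm_interpolant refl feasible.
have [c cf] := min_norm_representer Lf fmin.
exists f; last by exists c.
split=> // g Lg; have := fmin g Lg; rewrite le_eqVlt => /predU1P[fg|fg].
  suff -> : f = g by [].
  have [f0|f0] := eqVneq f 0.
    by move: fg; rewrite f0 normr0 => /esym/normr0_eq0.
  (* [K] takes the same value at all interpolants, so its multiple by the inverse of [|f|] norms
     both [f] and [g]. *)
  pose K := \sum_i c i *: L i.
  have evK z : interpolates L y z -> ev K z = \sum_i c i * y i.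
    move=> Lz; rewrite dual_sumE; apply: eq_bigr => i _; rewrite -(Lz i).
    by [].
  have [K1 K2] := cf; have nf : 0 < `|f| by rewrite normr_gt0.
  have norming_K z : interpolates L y z -> `|z| = `|f| -> norming (`|f|^-1 *: K) z.
    move=> Lz zf; split=> [x|]; rewrite dual_scaleE.
      by rewrite ler_pdivrMl// -K2; exact: dual_le_norm.
    have Kf : ev K f = `|f| * `|f| by rewrite -{1}K2; exact: K1.
    by rewrite evK// -(evK f Lf) Kf zf mulKf ?gt_eqF.
  exact: (norming_unique conv (norming_K _ Lf erefl) (norming_K _ Lg (esym fg))).
(* Both norms may lie in [radii]; an intermediate radius separates the two values of [Omega]. *)
have mid : `|f| < (`|f| + `|g|) / 2 < `|g| by apply/andP; split; lra.
move: mid => /andP[fm mg].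
by apply: le_trans (up _ _ fm) (down _ _ _ mg); rewrite divr_ge0// addr_ge0.
Qed.

Lemma admissible_radial :
  strictly_convex_space B -> ~ one_dimensional B ->
  (exists2 y, Y y & y != 0) -> admissible Y Omega ->
  exists (h : R -> R) (radii : set R),
    [/\ {in `[0, +oo[ &, nondecreasing_fun h},
        countable radii /\ radii `<=` `[0, +oo[,
        forall r : R, radii r -> jump_discontinuity h r,
        forall f : B, ~ radii `|f| -> Omega f = h `|f|
      & forall f : B, radii `|f| ->
          (0 < `|f| -> lim (h t @[t --> `|f|^'-]) <= Omega f) /\
          Omega f <= lim (h t @[t --> `|f|^'+])].
Proof.
move=> conv dim1 Y0 adm.
have min0 f := admissible_min0 f adm.
have tang := admissible_tangentially_monotone conv Y0 adm.
have mono f g := @norm_monotone R B Omega tang dim1 f g min0.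
(* The zero space is not [one_dimensional] but has no unit vector; a constant [h] serves there. *)
have [[x x0]|triv] := pselect (exists x : B, x != 0); last first.
  exists (fun=> Omega 0), set0; split=> // [|f _].
    by split; [exact: countable0|exact: sub0set].
  by congr Omega; apply: contrapT => /eqP f0; apply: triv; exists f.
pose e := `|x|^-1 *: x; pose h t := Omega (t *: e).
have nte t : 0 <= t -> `|t *: e| = t.
  by move=> t0; rewrite !normrZ normfV normr_id mulVf ?normr_eq0// mulr1 ger0_norm.
have h_mono : {in `[0, +oo[ &, nondecreasing_fun h}.
  move=> s t; rewrite !in_itv/= !andbT => s0 t0.
  rewrite le_eqVlt => /predU1P[->//|st]; by apply: mono; rewrite !nte.
have right f : Omega f <= lim (h t @[t --> `|f|^'+]).
  apply: le_lim_at_right => // t ft; apply: mono.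
  by rewrite nte//; apply: le_trans (ltW ft).
have left f : 0 < `|f| -> lim (h t @[t --> `|f|^'-]) <= Omega f.
  by move=> f0; apply: lim_at_left_le => // t t0 tf; apply: mono; rewrite nte.
exists h, [set r | 0 <= r /\ jump_discontinuity h r]; split.
- exact: h_mono.
- split; first exact: jump_discontinuity_ge0_countable.
  by move=> r [r0 _]; rewrite /= in_itv/= andbT.
- by move=> r [].
- move=> f nf; have [->|f0] := eqVneq f 0.
    by rewrite normr0 /h scale0r.
  have fp : 0 < `|f| by rewrite normr_gt0.
  (* Away from the jumps the one-sided limits agree, and they enclose [Omega] at every point of the
     sphere through [f], in particular at [|f| *: e]. *)
  have lims : lim (h t @[t --> `|f|^'-]) = lim (h t @[t --> `|f|^'+]).
    apply/eqP/negPn/negP => nl; apply: nf; split=> //.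
    rewrite /jump_discontinuity gt_eqF//; split=> //.
      exact: is_cvg_at_left.
    exact: is_cvg_at_right.
  pose g := `|f| *: e; have ng : `|g| = `|f| by rewrite nte.
  have := left f fp; have := right f; have := right g; have := left g.
  rewrite ng lims => /(_ fp) a1 a2 a3 a4; rewrite -/(Omega g).
  by apply/eqP; rewrite eq_le (le_trans a3 a1) (le_trans a2 a4).
- by move=> f _; split; [exact: left|exact: right].
Qed.

End characterisation.

Unset Implicit Arguments.

Theorem theorem3p5 (R : realType) (B : completeNormedModType R)
    (hrefl : reflexive_space B) (hconv : strictly_convex_space B)
    (hdim : ~ one_dimensional B)
    (Y : set R) (hY : exists2 y : R, Y y & y != 0)
    (Omega : B -> R) :
  admissible Y Omega <->
  exists (h : R -> R) (radii : set R),
    [/\ {in `[0, +oo[ &, nondecreasing_fun h},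
        countable radii /\ radii `<=` `[0, +oo[,
        forall r : R, radii r -> jump_discontinuity h r,
        forall f : B, ~ radii `|f| -> Omega f = h `|f|
      & forall f : B, radii `|f| ->
          (0 < `|f| -> lim (h t @[t --> `|f|^'-]) <= Omega f) /\
          Omega f <= lim (h t @[t --> `|f|^'+])].
Proof.
split; first exact: admissible_radial.
move=> [h [radii [h_mono _ _ Omega_h Omega_lim]]].
exact: radial_admissible Omega_h Omega_lim.
Qed.
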